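(* For every $n$ there exists an injective $3$-Lipschitz map $\phi:\{0,1\}^n\to\{0,1\}^{2n+1}$ such that $\mathrm{XOR}(x)=\mathrm{Majority}(\phi(x))$ for all $x\in\{0,1\}^n$.
   Context: Distances are Hamming distances $\mathrm{dist}(x,y)=\sum_i|x_i-y_i|$; $\phi$ is $3$-Lipschitz if $\mathrm{dist}(\phi(x),\phi(y))\le 3\,\mathrm{dist}(x,y)$ for all $x,y$. $\mathrm{XOR}(x)=\sum_{i=1}^n x_i\bmod 2$ on $\{0,1\}^n$, and on $\{0,1\}^{m}$, $\mathrm{Majority}(z)=1$ if $\sum_i z_i>m/2$ and $0$ otherwise. *)

(* Defs.v *)
From mathcomp Require Import all_boot.

Set Implicit Arguments.
Unset Strict Implicit.
Unset Printing Implicit Defensive.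

Notation cube n := (n.-tuple bool).

(* For bits, |x_i - y_i| is 1 when x_i and y_i differ and 0 otherwise. *)
Definition hdist (n : nat) (x y : cube n) : nat :=
  \sum_(i < n) (tnth x i != tnth y i).

Definition lipschitz (k n m : nat) (phi : cube n -> cube m) : Prop :=
  forall x y : cube n, hdist (phi x) (phi y) <= k * hdist x y.

Definition XOR (n : nat) (x : cube n) : bool := odd (\sum_(i < n) tnth x i).

(* The condition \sum z_i > m / 2 (rational division) with the denominator
   cleared. *)
Definition Majority (m : nat) (z : cube m) : bool :=
  m < 2 * \sum_(i < m) tnth z i.

(* Main.v *)
Require Import Defs.
From mathcomp Require Import all_boot zify.

(** Take [phi x = (x, ~x, XOR x)]. The first [2n] coordinates always contain
    exactly [n] ones, so the last one decides the majority; flipping one bit of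
    [x] flips exactly three coordinates. *)

(** Sums over a zipped list split along concatenation, which lets the distance between images be
    computed block by block. *)
Lemma hdist_zip (n : nat) (x y : n.-tuple bool) :
  hdist x y = \sum_(p <- zip x y) (p.1 != p.2).
Proof.
rewrite (big_tuple _ _ (zip_tuple x y)) /hdist.
apply: eq_bigr => i _.
by rewrite (tnth_nth (false, false)) /= nth_zip ?size_tuple //= -!tnth_nth.
Qed.

(** Modulo 2, the difference of two bits equals their sum, so the parities can be compared
    coordinate by coordinate. *)
Lemma odd_hdist (n : nat) (x y : n.-tuple bool) :
  odd (hdist x y) = XOR x (+) XOR y.
Proof.
rewrite /XOR -oddD -big_split /hdist.
apply: (big_ind2 (fun a b => odd a = odd b)) => // [a b c d ab cd|i _].
  by rewrite !oddD ab cd.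
by case: (tnth x i) (tnth y i) => [] [].
Qed.

(** If the XORs differ, the distance is odd, hence nonzero. *)
Lemma XOR_neq_leq_hdist (n : nat) (x y : n.-tuple bool) :
  (XOR x != XOR y) <= hdist x y.
Proof.
by rewrite negb_eqb -odd_hdist; case: (hdist x y) => // k; case: odd.
Qed.

Lemma sum_neq_zip_map_negb (s t : seq bool) :
  \sum_(p <- zip (map negb s) (map negb t)) (p.1 != p.2) =
  \sum_(p <- zip s t) (p.1 != p.2).
Proof.
elim: s t => [|a s IHs] [|b t]; rewrite ?big_nil //= !big_cons IHs /=.
by case: a b => [] [].
Qed.

Definition xor_to_majority_seq (n : nat) (x : n.-tuple bool) : seq bool :=
  x ++ map negb x ++ [:: XOR x].

Lemma size_xor_to_majority_seq (n : nat) (x : n.-tuple bool) :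
  size (xor_to_majority_seq n x) == 2 * n + 1.
Proof. by rewrite !size_cat size_map size_tuple /=; lia. Qed.

Definition xor_to_majority (n : nat) (x : n.-tuple bool) :
  (2 * n + 1).-tuple bool := Tuple (size_xor_to_majority_seq n x).

Lemma xor_to_majority_inj (n : nat) : injective (xor_to_majority n).
Proof.
(* The first block of the image is [x] itself. *)
move=> x y /(congr1 (take n \o val)) /=.
by rewrite !take_size_cat ?size_tuple // => /val_inj.
Qed.

Lemma hdist_xor_to_majority (n : nat) (x y : n.-tuple bool) :
  hdist (xor_to_majority n x) (xor_to_majority n y) =
  2 * hdist x y + (XOR x != XOR y).
Proof.
rewrite !hdist_zip /= /xor_to_majority_seq !zip_cat ?size_map ?size_tuple //.
rewrite !big_cat big_seq1 /= sum_neq_zip_map_negb.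
by rewrite mulSn mul1n addnA.
Qed.

Lemma sum_xor_to_majority (n : nat) (x : n.-tuple bool) :
  \sum_(i < 2 * n + 1) tnth (xor_to_majority n x) i = n + XOR x.
Proof.
rewrite -(big_tuple _ _ (xor_to_majority n x) predT nat_of_bool) /=.
(* The first two blocks merge into one sum over the bits [b] of [x], with terms [b + ~~ b = 1]. *)
rewrite !big_cat big_seq1 big_map /= addnA -big_split /=; congr (_ + _).
rewrite (eq_bigr (fun=> 1)) => [|[]//].
by rewrite sum1_size size_tuple.
Qed.

Theorem theorem1p3 (n : nat) :
  exists phi : n.-tuple bool -> (2 * n + 1).-tuple bool,
    [/\ injective phi,
        lipschitz 3 phi
      & forall x : n.-tuple bool, XOR x = Majority (phi x)].
Proof.
exists (xor_to_majority n); split=> [|x y|x].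
- exact: xor_to_majority_inj.
(* Split 3 as 2 + 1: the third copy of the distance pays for the XOR bit. *)
- by rewrite hdist_xor_to_majority (mulSnr 2) leq_add2l XOR_neq_leq_hdist.
(* Twice the number of ones is [2 * n] or [2 * n + 2], on either side of the length [2 * n + 1]. *)
- by rewrite /Majority sum_xor_to_majority; case: (XOR x); lia.
Qed.
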